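(* Let $f\colon A\to B$, $r\colon B\to A$, $g\colon C\to B$, $s\colon B\to C$, $\alpha\colon A\to D$, $\beta\colon B\to D$, $\gamma\colon C\to D$ be morphisms in the category $\mathcal{S}$ of cancellative conjugation semigroups, with $fr=gs=1_B$ and $\alpha r=\beta=\gamma s$. Then the diagram formed by these morphisms is admissible in $\mathcal{S}$ if and only if the following two conditions hold: (Ad1) the equation $$x+\overline{\beta(b)}+\beta(b)=\alpha(a)+\overline{\beta(b)}+\gamma(c)$$ has a unique solution $x\in D$ for all $a\in A$ and $c\in C$ such that $f(a)=g(c)=b\in B$; (Ad2) the equality $$\alpha(a_1+a_2)+\overline{\beta(b_1+b_2)}+\gamma(c_1+c_2)=\alpha(a_1)+\overline{\beta(b_1)}+\gamma(c_1)+\alpha(a_2)+\overline{\beta(b_2)}+\gamma(c_2)$$ is satisfied for all $a_1,a_2\in A$ and $c_1,c_2\in C$ such that $f(a_1)=g(c_1)=b_1\in B$ and $f(a_2)=g(c_2)=b_2\in B$.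
   Context: A conjugation semigroup $(S,+,\overline{(\;)})$ is a semigroup $(S,+)$ (written additively but not assumed commutative) equipped with a unary operation $\overline{(\;)}\colon S\to S$ satisfying, for all $x,y\in S$: (1) $\overline{x}+x=x+\overline{x}$; (2) $x+\overline{y}+y=y+\overline{y}+x$; (3) $\overline{(x+y)}=\overline{y}+\overline{x}$. It is cancellative if its underlying semigroup is (left and right) cancellative. The category $\mathcal{S}$ has cancellative conjugation semigroups as objects and semigroup homomorphisms preserving the conjugation as morphisms. Given morphisms $f,r,g,s,\alpha,\beta,\gamma$ with $fr=1_B=gs$ and $\alpha r=\beta=\gamma s$, let $A\times_B C=\{(a,c)\mid f(a)=g(c)\}$ be the pullback of $f$ and $g$, and let $e_1=\langle 1_A,sf\rangle\colon A\to A\times_B C$ and $e_2=\langle rg,1_C\rangle\colon C\to A\times_B C$. The diagram is called admissible if there exists a unique morphism $\varphi\colon A\times_B C\to D$ (in the category) such that $\varphi e_1=\alpha$ and $\varphi e_2=\gamma$. *)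

(* Defs.v *)
From HB Require Import structures.
From mathcomp Require Import ssreflect ssrfun nmodule.
From Stdlib Require Import ProofIrrelevance FunctionalExtensionality.

Set Implicit Arguments.
Unset Strict Implicit.
Unset Printing Implicit Defensive.

Import Algebra.
Local Open Scope ring_scope.

(* The law + of a [baseAddMagmaType] is not assumed commutative, and the
   carrier is an arbitrary type ([addSemigroupType] is commutative and
   requires a choice structure).  [bar x] is the conjugate of x. *)
HB.mixin Record isConjSemigroup S of BaseAddMagma S := {
  bar : S -> S;
  addcA : associative (@add S);
  addbarC : forall x : S, bar x + x = x + bar x;
  addbarCA : forall x y : S, x + bar y + y = y + bar y + x;
  barD : forall x y : S, bar (x + y) = bar y + bar x
}.

#[short(type="conjSemigroupType")]
HB.structure Definition ConjSemigroup :=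
  {S of BaseAddMagma S & isConjSemigroup S}.

HB.mixin Record isCancellative S of BaseAddMagma S := {
  addcI : right_injective (@add S);
  addIc : left_injective (@add S)
}.

#[short(type="cancelConjSemigroupType")]
HB.structure Definition CancelConjSemigroup :=
  {S of ConjSemigroup S & isCancellative S}.

Bind Scope ring_scope with ConjSemigroup.sort CancelConjSemigroup.sort.

HB.mixin Record isConjMorphism (S T : conjSemigroupType) (h : S -> T) := {
  cmorphD : {morph h : x y / x + y};
  cmorph_bar : {morph h : x / bar x}
}.

HB.structure Definition ConjMorphism (S T : conjSemigroupType) :=
  {h of isConjMorphism S T h}.

Notation "{ 'conj' S -> T }" := (ConjMorphism.type S%type T%type)
  (at level 0, S at level 98, T at level 99, format "{ 'conj'  S  ->  T }")
  : type_scope.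

Lemma cmorph_ext (S T : conjSemigroupType) (h k : {conj S -> T}) :
  h =1 k -> h = k.
Proof.
case: h k => [h [[hD hb]]] [k [[kD kb]]] /functional_extensionality /= ehk.
move: kD kb; case: _ / ehk => kD kb.
by rewrite (proof_irrelevance _ kD hD) (proof_irrelevance _ kb hb).
Qed.

Section Pullback.

Variables (A B C : cancelConjSemigroupType).
Variables (f : {conj A -> B}) (g : {conj C -> B}).

Definition pullback : Type := {p : A * C | f p.1 = g p.2}.

Lemma pullback_eq (p q : pullback) :
  (sval p).1 = (sval q).1 -> (sval p).2 = (sval q).2 -> p = q.
Proof.
case: p q => [[a c] /= e] [[a' c'] /= e'] /= ea ec.
by move: e'; case: _ / ea; case: _ / ec => e'; rewrite (proof_irrelevance _ e e').
Qed.

Fact pullback_add_proof (p q : pullback) :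
  f ((sval p).1 + (sval q).1) = g ((sval p).2 + (sval q).2).
Proof. by rewrite !cmorphD (svalP p) (svalP q). Qed.

Fact pullback_bar_proof (p : pullback) :
  f (bar (sval p).1) = g (bar (sval p).2).
Proof. by rewrite !cmorph_bar (svalP p). Qed.

Definition pullback_add (p q : pullback) : pullback :=
  exist _ ((sval p).1 + (sval q).1, (sval p).2 + (sval q).2)
    (pullback_add_proof p q).

Definition pullback_bar (p : pullback) : pullback :=
  exist _ (bar (sval p).1, bar (sval p).2) (pullback_bar_proof p).

HB.instance Definition _ := hasAdd.Build pullback pullback_add.

Fact pullback_addA : associative (@add pullback).
Proof. by move=> p q t; apply: pullback_eq; apply: addcA. Qed.

Fact pullback_addbarC (p : pullback) : pullback_bar p + p = p + pullback_bar p.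
Proof. by apply: pullback_eq; apply: addbarC. Qed.

Fact pullback_addbarCA (p q : pullback) :
  p + pullback_bar q + q = q + pullback_bar q + p.
Proof. by apply: pullback_eq; apply: addbarCA. Qed.

Fact pullback_barD (p q : pullback) :
  pullback_bar (p + q) = pullback_bar q + pullback_bar p.
Proof. by apply: pullback_eq; apply: barD. Qed.

HB.instance Definition _ := isConjSemigroup.Build pullback
  pullback_addA pullback_addbarC pullback_addbarCA pullback_barD.

Fact pullback_addI : right_injective (@add pullback).
Proof.
move=> p q t e; apply: pullback_eq; apply: addcI.
- exact: (congr1 (fun z : pullback => (sval z).1) e).
- exact: (congr1 (fun z : pullback => (sval z).2) e).
Qed.

Fact pullback_Iadd : left_injective (@add pullback).
Proof.
move=> p q t e; apply: pullback_eq; apply: addIc.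
- exact: (congr1 (fun z : pullback => (sval z).1) e).
- exact: (congr1 (fun z : pullback => (sval z).2) e).
Qed.

HB.instance Definition _ :=
  isCancellative.Build pullback pullback_addI pullback_Iadd.

End Pullback.

Section Injections.

Variables (A B C : cancelConjSemigroupType).
Variables (f : {conj A -> B}) (r : {conj B -> A}).
Variables (g : {conj C -> B}) (s : {conj B -> C}).
Hypotheses (fr : f \o r =1 id) (gs : g \o s =1 id).

Definition pb_inl (a : A) : pullback f g :=
  exist _ (a, s (f a)) (esym (gs (f a))).

Definition pb_inr (c : C) : pullback f g :=
  exist _ (r (g c), c) (fr (g c)).

Fact pb_inlD : {morph pb_inl : x y / x + y}.
Proof. by move=> x y; apply: pullback_eq; rewrite //= !cmorphD. Qed.

Fact pb_inl_bar : {morph pb_inl : x / bar x}.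
Proof. by move=> x; apply: pullback_eq; rewrite //= !cmorph_bar. Qed.

HB.instance Definition _ :=
  isConjMorphism.Build A (pullback f g) pb_inl pb_inlD pb_inl_bar.

Fact pb_inrD : {morph pb_inr : x y / x + y}.
Proof. by move=> x y; apply: pullback_eq; rewrite //= !cmorphD. Qed.

Fact pb_inr_bar : {morph pb_inr : x / bar x}.
Proof. by move=> x; apply: pullback_eq; rewrite //= !cmorph_bar. Qed.

HB.instance Definition _ :=
  isConjMorphism.Build C (pullback f g) pb_inr pb_inrD pb_inr_bar.

End Injections.

Definition admissible (A B C D : cancelConjSemigroupType)
    (f : {conj A -> B}) (r : {conj B -> A})
    (g : {conj C -> B}) (s : {conj B -> C})
    (alpha : {conj A -> D}) (gamma : {conj C -> D})
    (fr : f \o r =1 id) (gs : g \o s =1 id) : Prop :=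
  exists! phi : {conj pullback f g -> D},
    phi \o pb_inl f gs =1 alpha /\ phi \o pb_inr g fr =1 gamma.

(* Main.v *)
Require Import Defs.
From HB Require Import structures.
From mathcomp Require Import ssreflect ssrfun nmodule.
From Stdlib Require Import IndefiniteDescription.

(** The element [cnorm y = bar y + y] is central, and [cnorm] is additive.  In
    the pullback, a pair [p = (a, c)] over [b = f a = g c] is in general not a
    sum of elements coming from [A] and [C], but its translate by the norm of
    [(r b, s b)] is such a sum, as [e1 \o r] and [e2 \o s] both send [b] to
    [(r b, s b)]:

      [p + cnorm (r b, s b) = e1 a + (r (bar b), s (bar b)) + e2 c],

    and the same translate is also [e2 c + (r (bar b), s (bar b)) + e1 a].
    Hence an additive [h] extending [alpha] and [gamma] satisfies

      [h p + cnorm (beta b) = alpha a + bar (beta b) + gamma c],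

    and cancellation determines [h p] from this equation (lemma
    [extension_formula]).  This gives the uniqueness of [phi] and the
    necessity of (Ad1), and, since norms are central and additive, it makes the
    additivity of a function solving (Ad1) equivalent to (Ad2) (lemma
    [cnorm_shift_add]).

    It remains to see that the function given by (Ad1) and (Ad2) preserves
    conjugation, although neither condition mentions the conjugate of a pair.
    Conjugating the equation at [p] reverses the order of its right-hand side,
    and produces [gamma c' + bar (beta b') + alpha a'], with [(a', c')] the
    conjugate of [p] and [b'] that of [b].  The two decompositions above show
    that an additive extension cannot distinguish this from
    [alpha a' + bar (beta b') + gamma c'] (lemma [extension_bar]). *)

Local Open Scope ring_scope.

Set Implicit Arguments.
Unset Strict Implicit.

Section Norm.

Variable S : conjSemigroupType.
Implicit Types x y : S.

Definition cnorm y : S := bar y + y.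

Lemma cnormC x y : x + cnorm y = cnorm y + x.
Proof. by rewrite /cnorm addcA addbarCA -addbarC. Qed.

Lemma cnormD x y : cnorm (x + y) = cnorm x + cnorm y.
Proof.
rewrite {1}/cnorm barD -addcA (addcA (bar x)) -/(cnorm x) -(cnormC y).
by rewrite addcA -/(cnorm y) cnormC.
Qed.

Lemma bar_cnorm y : bar (cnorm y) = cnorm (bar y).
Proof. by rewrite /cnorm barD -addbarC. Qed.

Lemma cnorm_shift_add x1 x2 y1 y2 :
  (x1 + x2) + cnorm (y1 + y2) = (x1 + cnorm y1) + (x2 + cnorm y2).
Proof.
by rewrite cnormD (addcA (x1 + x2)) -(addcA x1 x2) (cnormC x2 y1) !addcA.
Qed.

End Norm.

Section Extension.

Variables (A B C D : cancelConjSemigroupType).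
Variables (f : {conj A -> B}) (r : {conj B -> A}).
Variables (g : {conj C -> B}) (s : {conj B -> C}).
Variables (alpha : {conj A -> D}) (beta : {conj B -> D}).
Variable gamma : {conj C -> D}.
Hypotheses (fr : f \o r =1 id) (gs : g \o s =1 id).
Hypotheses (alpha_r : alpha \o r =1 beta) (gamma_s : gamma \o s =1 beta).

Let e1 := pb_inl f gs.
Let e2 := pb_inr g fr.

(** Centrality of norms is used in one coordinate only: in the first one here,
    both sides are already the same sum, and in the second one they are
    [c + bar y + y] and [y + bar y + c] with [y = s b].  In the reversed
    version the coordinates exchange their roles. *)
Lemma pullback_decomp (p : pullback f g) (b := f (sval p).1) :
  p + e1 (r (bar b)) + e1 (r b) =
  e1 (sval p).1 + e1 (r (bar b)) + e2 (sval p).2.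
Proof.
have frE x : f (r x) = x := fr x.
apply: pullback_eq; rewrite /= ?frE /b; first by rewrite (svalP p).
by rewrite cmorph_bar addbarCA.
Qed.

Lemma pullback_decomp_rev (p : pullback f g) (b := f (sval p).1) :
  p + e1 (r (bar b)) + e1 (r b) =
  e2 (sval p).2 + e1 (r (bar b)) + e1 (sval p).1.
Proof.
have frE x : f (r x) = x := fr x.
apply: pullback_eq; rewrite /= ?frE /b //.
by rewrite cmorph_bar addbarCA (svalP p).
Qed.

Section Additive.

Variable h : pullback f g -> D.
Hypothesis hD : {morph h : p q / p + q}.
Hypotheses (h_e1 : h \o e1 =1 alpha) (h_e2 : h \o e2 =1 gamma).

Let h_e1E a : h (e1 a) = alpha a := h_e1 a.
Let h_e2E c : h (e2 c) = gamma c := h_e2 c.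
Let alpha_rE b : alpha (r b) = beta b := alpha_r b.

Lemma extension_formula (p : pullback f g) (b := f (sval p).1) :
  h p + cnorm (beta b) =
  alpha (sval p).1 + bar (beta b) + gamma (sval p).2.
Proof.
have := congr1 h (pullback_decomp p).
by rewrite !hD !h_e1E h_e2E !alpha_rE cmorph_bar -!addcA.
Qed.

Lemma extension_formula_rev (p : pullback f g) (b := f (sval p).1) :
  h p + cnorm (beta b) =
  gamma (sval p).2 + bar (beta b) + alpha (sval p).1.
Proof.
have := congr1 h (pullback_decomp_rev p).
by rewrite !hD !h_e1E h_e2E !alpha_rE cmorph_bar -!addcA.
Qed.

(** Conjugating [extension_formula] at [p] yields the right-hand side of
    [extension_formula_rev] at the conjugate of [p]. *)
Lemma extension_bar : {morph h : p / bar p}.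
Proof.
move=> p; apply: (addIc (cnorm (beta (f (sval (bar p)).1)))).
rewrite extension_formula_rev /= !cmorph_bar cnormC -bar_cnorm.
by rewrite -[RHS]barD extension_formula !barD addcA.
Qed.

End Additive.

(** Two additive extensions satisfy the same equations (Ad1), whose solutions
    are unique by cancellation. *)
Lemma extension_unique (h k : pullback f g -> D) :
    {morph h : p q / p + q} -> h \o e1 =1 alpha -> h \o e2 =1 gamma ->
    {morph k : p q / p + q} -> k \o e1 =1 alpha -> k \o e2 =1 gamma ->
  h =1 k.
Proof.
move=> hD h1 h2 kD k1 k2 p; apply: (addIc (cnorm (beta (f (sval p).1)))).
by rewrite !extension_formula.
Qed.

(** On the image of [A] the equation reads
    [x + cnorm (beta b) = alpha a + cnorm (beta b)], and similarly for [C] up to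
    the commutation of [bar (beta b)] with [beta b]. *)
Lemma solution_extends (h : pullback f g -> D) :
    (forall p, h p + cnorm (beta (f (sval p).1)) =
       alpha (sval p).1 + bar (beta (f (sval p).1)) + gamma (sval p).2) ->
  h \o e1 =1 alpha /\ h \o e2 =1 gamma.
Proof.
move=> hE; split=> [a|c].
  apply: (addIc (cnorm (beta (f a)))); rewrite /= (hE (e1 a)) /=.
  by rewrite [gamma _]gamma_s -addcA.
apply: (addIc (cnorm (beta (g c)))); have := hE (e2 c).
rewrite /= [f (r (g c))]fr [alpha (r _)]alpha_r => ->.
by rewrite cnormC /cnorm addbarC.
Qed.

End Extension.

Theorem theorem4p1 (A B C D : cancelConjSemigroupType)
    (f : {conj A -> B}) (r : {conj B -> A})
    (g : {conj C -> B}) (s : {conj B -> C})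
    (alpha : {conj A -> D}) (beta : {conj B -> D}) (gamma : {conj C -> D})
    (fr : f \o r =1 id) (gs : g \o s =1 id)
    (alpha_r : alpha \o r =1 beta) (gamma_s : gamma \o s =1 beta) :
  admissible alpha gamma fr gs <->
    (forall (a : A) (c : C) (b : B), f a = b -> g c = b ->
       exists! x : D,
         x + bar (beta b) + beta b = alpha a + bar (beta b) + gamma c) /\
    (forall (a1 a2 : A) (c1 c2 : C) (b1 b2 : B),
       f a1 = b1 -> g c1 = b1 -> f a2 = b2 -> g c2 = b2 ->
       alpha (a1 + a2) + bar (beta (b1 + b2)) + gamma (c1 + c2) =
       alpha a1 + bar (beta b1) + gamma c1
         + alpha a2 + bar (beta b2) + gamma c2).
Proof.
split.
  move=> [phi [[phi1 phi2] _]].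
  have phiD : {morph phi : p q / p + q} by exact: cmorphD.
  have phiE := extension_formula alpha_r phiD phi1 phi2.
  split=> [a c b fa gc | a1 a2 c1 c2 b1 b2 fa1 gc1 fa2 gc2].
    pose p : pullback f g := exist _ (a, c) (etrans fa (esym gc)).
    have := phiE p; rewrite /= fa => pE.
    exists (phi p); split=> [|x xE]; first by rewrite -pE addcA.
    by apply: (addIc (cnorm (beta b))); rewrite pE -xE addcA.
  pose p1 : pullback f g := exist _ (a1, c1) (etrans fa1 (esym gc1)).
  pose p2 : pullback f g := exist _ (a2, c2) (etrans fa2 (esym gc2)).
  have := phiE (p1 + p2); rewrite phiD /= !cmorphD cnorm_shift_add !phiE /=.
  by rewrite fa1 fa2 !addcA => ->.
move=> [Ad1 Ad2].
have /functional_choice [h hE] (p : pullback f g) : exists x : D,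
    x + cnorm (beta (f (sval p).1)) =
    alpha (sval p).1 + bar (beta (f (sval p).1)) + gamma (sval p).2.
  have [x [xE _]] := Ad1 _ _ _ erefl (esym (svalP p)).
  by exists x; rewrite -xE addcA.
have hD : {morph h : p q / p + q}.
  move=> p q; apply: (addIc (cnorm (beta (f (sval (p + q)).1)))).
  have := Ad2 _ _ _ _ _ _ erefl (esym (svalP p)) erefl (esym (svalP q)).
  by rewrite hE /= !cmorphD cnorm_shift_add !hE => ->; rewrite !addcA.
have [h1 h2] := solution_extends fr gs alpha_r gamma_s hE.
have hbar := extension_bar alpha_r hD h1 h2.
pose phi : {conj pullback f g -> D} :=
  HB.pack h (isConjMorphism.Build _ _ h hD hbar).
exists phi; split=> [//|psi [psi1 psi2]]; apply: cmorph_ext.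
exact: (extension_unique alpha_r hD h1 h2 (@cmorphD _ _ psi) psi1 psi2).
Qed.
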